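(* Let $X$ be a terminating left-monomial $1$-polygraph. The following assertions are equivalent: (i) $X$ is confluent. (ii) Every $0$-cell of $I(X)$ admits $0$ as a normal form. (iii) As a vector space, the free algebra $\mathcal{A}(X_0)$ admits the direct decomposition $\mathcal{A}(X_0)=\mathrm{Red}(X)\oplus I(X)$.
   Context: Fix a field $\mathbb{K}$; algebras are unital associative $\mathbb{K}$-algebras. A $1$-polygraph $X=\langle X_0\,|\,X_1\rangle$ is a set $X_0$ and a set $X_1$ (of ''$1$-cells'') with two maps $s,t:X_1\to\mathcal{A}(X_0)$ into the free algebra on $X_0$. $I(X)$ is the two-sided ideal of $\mathcal{A}(X_0)$ generated by the boundaries $\partial(\alpha)=s(\alpha)-t(\alpha)$, $\alpha\in X_1$. Monomials are the elements of the free monoid $X_0^*$; they form a linear basis of $\mathcal{A}(X_0)$, and $\mathrm{supp}(a)$ is the set of monomials with nonzero coefficient in $a$. $X$ is left-monomial if, for each $\alpha\in X_1$, $s(\alpha)$ is a monomial not belonging to $\mathrm{supp}(t(\alpha))$. The free $1$-algebra $\mathcal{A}(X)$ has as $0$-cells the elements of $\mathcal{A}(X_0)$; its $1$-cells are the elements of the quotient of the $\mathcal{A}(X_0)$-bimodule $(\mathcal{A}(X_0)\otimes\mathbb{K}X_1\otimes\mathcal{A}(X_0))\oplus\mathcal{A}(X_0)$ by the sub-bimodule generated by the elements $(a s(b)+t(a)b-t(a)s(b))-(s(a)b+a t(b)-s(a)t(b))$ for $a,b$ in the first summand, where $s(a\alpha b)=a s(\alpha) b$, $t(a\alpha b)=a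 t(\alpha) b$, and an element $c$ of the second summand is the identity $1_c$, with source and target $c$. Composition of $f:a\to b$ and $g:b\to c$ is $f\star_0 g=f-1_b+g$. A $1$-monomial is a $1$-cell $u\alpha v$ with $u,v$ monomials and $\alpha\in X_1$. Let $X$ be left-monomial. A rewriting step is a $1$-cell $\lambda f+1_a$ with $f$ a $1$-monomial, $\lambda\in\mathbb{K}\setminus\{0\}$ and $a$ a $0$-cell with $s(f)\notin\mathrm{supp}(a)$. A positive $1$-cell is a (possibly empty) composite of rewriting steps. A $0$-cell is reduced if it is not the source of a rewriting step; reduced $0$-cells form the linear subspace $\mathrm{Red}(X)$ of $\mathcal{A}(X_0)$. A normal form of $a$ is a reduced $0$-cell $b$ such that there is a positive $1$-cell $a\to b$. Let $\succ_X$ be the smallest transitive relation on $X_0^*$ that is stable by product ($u\succ u'$ implies $vuw\succ vu'w$) and such that $s(\alpha)\succ_X v$ for all $\alpha\in X_1$, $v\in\mathrm{supp}(t(\alpha))$; $X$ terminates if $\succ_X$ is wellfounded. $X$ is confluent if, for all positive $1$-cells $f,g$ with the same source, there are positive $1$-cells $h,k$ with $s(h)=t(f)$, $s(k)=t(g)$ and $t(h)=t(k)$. *)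

(* Defs.v *)
From HB Require Import structures.
From mathcomp Require Import all_boot all_algebra.
From mathcomp Require Import finmap.
From mathcomp Require Import monalg.
From mathcomp Require Import boolp.

Set Implicit Arguments.
Unset Strict Implicit.
Unset Printing Implicit Defensive.

Import GRing.Theory.
Import Quotient.
Local Open Scope ring_scope.
Local Open Scope quotient_scope.

(* The monoid algebra of the free monoid {fmonom X0}: its basis elements << m >>
   are the monomials, and msupp is the support. *)
Notation free_alg K X0 := {malg K[{fmonom X0}]}.

Record polygraph1 (K : fieldType) := Polygraph1 {
  gen0 : choiceType;
  gen1 : choiceType;
  gsrc : gen1 -> free_alg K gen0;
  gtgt : gen1 -> free_alg K gen0
}.

Definition lin_ext (K : fieldType) (T : choiceType) (V : lmodType K)
    (f : T -> V) (x : {malg K[T]}) : V :=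
  \sum_(k <- msupp x) x@_k *: f k.

Section LinExt.
Variables (K : fieldType) (T : choiceType).

Lemma lin_extEw (V : lmodType K) (f : T -> V) (x : {malg K[T]}) (d : {fset T}) :
  (msupp x `<=` d)%fset -> lin_ext f x = \sum_(k <- d) x@_k *: f k.
Proof.
move=> le_xd; rewrite /lin_ext (big_fset_incl _ le_xd) // => k _ k_x.
by rewrite mcoeff_outdom // scale0r.
Qed.

Lemma lin_ext_linear (V : lmodType K) (f : T -> V) : linear (lin_ext f).
Proof.
move=> c x y; pose d := (msupp x `|` msupp y `|` msupp (c *: x + y))%fset.
rewrite !(@lin_extEw _ _ _ d); last first.
- by rewrite /d fsubsetUr.
- by rewrite /d -fsetUA fsubsetUl.
- by rewrite /d fsetUAC fsubsetUr.
rewrite scaler_sumr -big_split; apply: eq_bigr => k _ /=.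
by rewrite mcoeffD mcoeffZ scalerDl scalerA.
Qed.

HB.instance Definition _ (V : lmodType K) (f : T -> V) :=
  GRing.isLinear.Build K {malg K[T]} V *:%R (lin_ext f) (lin_ext_linear f).

Lemma lin_extU (V : lmodType K) (f : T -> V) k : lin_ext f << k >> = f k.
Proof.
rewrite (@lin_extEw _ _ _ [fset k]%fset) ?msuppU_le //.
by rewrite big_seq_fset1 mcoeffUU scale1r.
Qed.

Lemma lin_ext_id (x : {malg K[T]}) :
  lin_ext (fun k => << k >> : {malg K[T]}) x = x.
Proof.
rewrite [RHS]monalgE /lin_ext; apply: eq_bigr => k _.
by apply/malgP => k'; rewrite mcoeffZ !mcoeffU mulrnAr mulr1.
Qed.

Lemma eq_lin_ext (V : lmodType K) (f f' : T -> V) x :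
  f =1 f' -> lin_ext f x = lin_ext f' x.
Proof. by move=> ff'; apply: eq_bigr => k _; rewrite ff'. Qed.

Lemma lin_ext_comp (V W : lmodType K) (L : {linear V -> W}) (f : T -> V) x :
  L (lin_ext f x) = lin_ext (fun k => L (f k)) x.
Proof.
by rewrite /lin_ext linear_sum; apply: eq_bigr => k _; rewrite linearZ.
Qed.
End LinExt.

Lemma malg_scaleAr (K : fieldType) (M : monomType) c (a b : {malg K[M]}) :
  c *: (a * b) = a * (c *: b).
Proof.
apply/malgP => k; pose d := (msupp b `|` msupp (c *: b))%fset.
rewrite mcoeffZ !(@mcoeffMlw _ _ (msupp a) d) ?fsubsetUl ?fsubsetUr //.
rewrite mulr_sumr; apply: eq_bigr => k1 _; rewrite mulr_sumr.
by apply: eq_bigr => k2 _; rewrite mcoeffZ mulrnAr mulrCA.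
Qed.

Lemma malgUM (K : fieldType) (M : monomType) (k1 k2 : M) :
  << mmul k1 k2 >> = << k1 >> * << k2 >> :> {malg K[M]}.
Proof. by rewrite malgM_def fgmulUU mulr1. Qed.

Section LinExtMul.
Variables (K : fieldType) (T : choiceType) (M : monomType).
Local Notation A := {malg K[M]}.
Implicit Types (f : T -> A) (x : {malg K[T]}) (a : A).

Lemma lin_ext_mull f x a : lin_ext f x * a = lin_ext (fun k => f k * a) x.
Proof.
by rewrite /lin_ext mulr_suml; apply: eq_bigr => k _; rewrite scalerAl.
Qed.

Lemma lin_ext_mulr f x a : a * lin_ext f x = lin_ext (fun k => a * f k) x.
Proof.
by rewrite /lin_ext mulr_sumr; apply: eq_bigr => k _; rewrite malg_scaleAr.
Qed.
End LinExtMul.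

Fact mulr_assoc5 (R : nzRingType) (m1 m2 m3 m4 m5 : R) :
  m1 * m2 * m3 * (m4 * m5) = m1 * (m2 * m3 * m4) * m5.
Proof. by rewrite !mulrA. Qed.

Fact exchange_sum (V : zmodType) (p q r : V) : p + q - q - (p + r - r) = 0.
Proof. by rewrite !addrK subrr. Qed.

Fact exchange_sumt (V : zmodType) (p q r : V) : p + q - p - (r + q - r) = 0.
Proof. by rewrite ![_ + q]addrC !addrK subrr. Qed.

Section FreeOneAlgebra.
Variables (K : fieldType) (X : polygraph1 K).
Local Notation A := (free_alg K (gen0 X)).

Definition boundary (al : gen1 X) : A := gsrc al - gtgt al.

Inductive in_ideal : A -> Prop :=
| in_ideal_gen al : in_ideal (boundary al)
| in_ideal0 : in_ideal 0
| in_idealD a b : in_ideal a -> in_ideal b -> in_ideal (a + b)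
| in_idealM a b c : in_ideal b -> in_ideal (a * b * c).

(* The A-bimodule A (x) K X1 (x) A is encoded by its linear basis of elements
   u (x) al (x) v, with u and v monomials. *)
Definition basis1 : choiceType :=
  ({fmonom gen0 X} * gen1 X * {fmonom gen0 X})%type.

Definition tens1 : lmodType K := {malg K[basis1]}.

(* a . x . b for the bimodule structure *)
Definition tens_act (a : A) (x : tens1) (b : A) : tens1 :=
  lin_ext (fun u => lin_ext (fun w => lin_ext (fun v =>
    << (mmul u w.1.1, w.1.2, mmul w.2 v) >> : tens1) b) x) a.

(* Bimodule extension of a map defined on the generating 1-cells. *)
Definition tens_bd (g : gen1 X -> A) (x : tens1) : A :=
  lin_ext (fun w : basis1 => << w.1.1 >> * g w.1.2 * << w.2 >>) x.

Fact tens_bd_linear g : linear (tens_bd g).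
Proof. exact: lin_ext_linear. Qed.

HB.instance Definition _ g :=
  GRing.isLinear.Build K tens1 A *:%R (tens_bd g) (tens_bd_linear g).

Local Notation tsrc := (tens_bd (@gsrc K X)).
Local Notation ttgt := (tens_bd (@gtgt K X)).

(* The direct sum whose quotient is the bimodule of 1-cells; the component in A
   carries the identities. *)
Definition precell : lmodType K := (tens1 * A)%type.

Definition pre_act (a : A) (x : precell) (b : A) : precell :=
  (tens_act a x.1 b, a * x.2 * b).

Definition pre_src (x : precell) : A := tsrc x.1 + x.2.
Definition pre_tgt (x : precell) : A := ttgt x.1 + x.2.

(* (x s(y) + t(x) y - t(x) s(y)) - (s(x) y + x t(y) - s(x) t(y)) *)
Definition exchange (x y : tens1) : precell :=
  (tens_act 1 x (tsrc y) + tens_act (ttgt x) y 1, - (ttgt x * tsrc y))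
  - (tens_act (tsrc x) y 1 + tens_act 1 x (ttgt y), - (tsrc x * ttgt y)).

Inductive cell_rel : precell -> Prop :=
| cell_rel_gen x y : cell_rel (exchange x y)
| cell_rel0 : cell_rel 0
| cell_relD x y : cell_rel x -> cell_rel y -> cell_rel (x + y)
| cell_rel_act a x b : cell_rel x -> cell_rel (pre_act a x b).

Lemma tens_act_scale (c : K) (x : tens1) :
  tens_act (c *: 1) x 1 = c *: x.
Proof.
have mg1 : (1 : A) = << mone >> by [].
rewrite /tens_act linearZ /=; congr (_ *: _).
rewrite mg1 lin_extU -[RHS]lin_ext_id; apply: eq_bigr => w _.
by rewrite lin_extU mul1m mulm1; case: w => [[u al] v].
Qed.

Lemma cell_relZ c x : cell_rel x -> cell_rel (c *: x).
Proof.
move=> /(cell_rel_act (c *: 1) 1); rewrite /pre_act tens_act_scale.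
by rewrite mulr1 -scalerAl mul1r.
Qed.

Definition cell_relb : {pred precell} := fun x => `[< cell_rel x >].

Lemma cell_relb_zmod : zmod_closed cell_relb.
Proof.
split=> [|x y]; first by apply/asboolP; exact: cell_rel0.
move=> /asboolP x_rel /asboolP y_rel; apply/asboolP.
by apply: cell_relD => //; rewrite -scaleN1r; apply: cell_relZ.
Qed.

HB.instance Definition _ :=
  GRing.isZmodClosed.Build precell cell_relb cell_relb_zmod.

Definition cell : Type := {quot cell_relb}.
HB.instance Definition _ := Choice.on cell.
HB.instance Definition _ := ZmodQuotient.on cell.

Definition cell_of (x : precell) : cell := \pi_{quot cell_relb} x.

Fact cell_of_zmod : zmod_morphism cell_of.
Proof.
move=> x y; rewrite /cell_of.
exact: (pi_is_zmod_morphism {quot cell_relb} x y).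
Qed.

HB.instance Definition _ :=
  GRing.isZmodMorphism.Build precell cell cell_of cell_of_zmod.

Lemma cell_ofP (f : cell) : exists x, f = cell_of x.
Proof. by exists (repr f); rewrite /cell_of reprK. Qed.

Lemma eq_cellP (x y : precell) : cell_of x = cell_of y <-> cell_rel (x - y).
Proof.
split=> [/eqP|xy_rel]; first by rewrite /cell_of eqmodE => /asboolP.
by apply/eqP; rewrite /cell_of eqmodE; apply/asboolP.
Qed.

Lemma cell_rel_repr (x : precell) : cell_rel (repr (cell_of x) - x).
Proof. by apply/eq_cellP; rewrite /cell_of reprK. Qed.

Definition cell_scale (c : K) (f : cell) : cell := cell_of (c *: repr f).

Lemma cell_scaleE c (x : precell) :
  cell_scale c (cell_of x) = cell_of (c *: x).
Proof.
apply/eq_cellP; rewrite -scalerBr.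
by apply: cell_relZ; apply: cell_rel_repr.
Qed.

Fact cell_scaleA c d f : cell_scale c (cell_scale d f) = cell_scale (c * d) f.
Proof.
have [x ->] := cell_ofP f.
by rewrite (cell_scaleE d x) !(cell_scaleE _ _) scalerA.
Qed.

Fact cell_scale1 : left_id 1 cell_scale.
Proof. by move=> f; have [x ->] := cell_ofP f; rewrite cell_scaleE scale1r. Qed.

Fact cell_scaleDr : right_distributive cell_scale +%R.
Proof.
move=> c f g; have [x ->] := cell_ofP f; have [y ->] := cell_ofP g.
rewrite -raddfD (cell_scaleE c x) (cell_scaleE c y) cell_scaleE.
by rewrite -raddfD scalerDr.
Qed.

Fact cell_scaleDl f : {morph cell_scale^~ f : c d / c + d}.
Proof.
move=> c d; have [x ->] := cell_ofP f.
by rewrite !(cell_scaleE _ x) -raddfD scalerDl.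
Qed.

HB.instance Definition _ := GRing.Zmodule_isLmodule.Build K cell
  cell_scaleA cell_scale1 cell_scaleDr cell_scaleDl.

Lemma tens_bdU (g : gen1 X -> A) u al v :
  tens_bd g << (u, al, v) >> = << u >> * g al * << v >>.
Proof. exact: lin_extU. Qed.

Lemma tens_bdM (g : gen1 X -> A) a x b :
  tens_bd g (tens_act a x b) = a * tens_bd g x * b.
Proof.
rewrite -[in RHS](lin_ext_id a) -[in RHS](lin_ext_id b) /tens_act.
apply: etrans (lin_ext_comp (tens_bd g) _ _) _.
apply: etrans _ (esym (congr1 ( *%R^~ _) (lin_ext_mull _ _ _))).
apply: etrans _ (esym (lin_ext_mull _ _ _)); apply: eq_lin_ext => u.
apply: etrans (lin_ext_comp (tens_bd g) _ _) _.
apply: etrans _ (esym (congr1 ( *%R^~ _) (lin_ext_mulr _ _ _))).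
apply: etrans _ (esym (lin_ext_mull _ _ _)); apply: eq_lin_ext => -[[w1 al] w2].
apply: etrans (lin_ext_comp (tens_bd g) _ _) _.
apply: etrans _ (esym (lin_ext_mulr _ _ _)); apply: eq_lin_ext => v.
apply: etrans (tens_bdU _ _ _ _) _.
rewrite (malgUM K u w1) (malgUM K w2 v).
exact: mulr_assoc5.
Qed.

Fact pre_src_zmod : zmod_morphism pre_src.
Proof.
move=> x y; rewrite /pre_src [(x - y).1]/= [(x - y).2]/=.
by rewrite raddfB opprD addrACA.
Qed.

HB.instance Definition _ :=
  GRing.isZmodMorphism.Build precell A pre_src pre_src_zmod.

Lemma pre_src_act a x b : pre_src (pre_act a x b) = a * pre_src x * b.
Proof.
by rewrite /pre_src /pre_act [(_, _).1]/= [(_, _).2]/= tens_bdM mulrDr mulrDl.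
Qed.

Lemma pre_src_exchange x y : pre_src (exchange x y) = 0.
Proof.
rewrite /exchange raddfB.
have E (p q : tens1) (c p' q' : A) : tsrc p = p' -> tsrc q = q' ->
    pre_src (p + q, c) = p' + q' + c.
  by move=> <- <-; rewrite /pre_src raddfD.
have E2 c d : tsrc (tens_act c d 1) = c * tsrc d by rewrite tens_bdM mulr1.
have E1 d c : tsrc (tens_act 1 d c) = tsrc d * c by rewrite tens_bdM mul1r.
apply: etrans (exchange_sum _ _ _).
apply: (congr2 (fun u v : A => u - v)); first exact: E (E1 _ _) (E2 _ _).
exact: E (E2 _ _) (E1 _ _).
Qed.

Lemma pre_src_rel x : cell_rel x -> pre_src x = 0.
Proof.
elim=> {x} [x y||x y _ x0 _ y0|a x b _ x0].
- exact: pre_src_exchange.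
- exact: raddf0.
- by apply: etrans (raddfD _ _ _) (etrans (congr2 +%R x0 y0) (addr0 _)).
- by rewrite pre_src_act x0 mulr0 mul0r.
Qed.

Fact pre_tgt_zmod : zmod_morphism pre_tgt.
Proof.
move=> x y; rewrite /pre_tgt [(x - y).1]/= [(x - y).2]/=.
by rewrite raddfB opprD addrACA.
Qed.

HB.instance Definition _ :=
  GRing.isZmodMorphism.Build precell A pre_tgt pre_tgt_zmod.

Lemma pre_tgt_act a x b : pre_tgt (pre_act a x b) = a * pre_tgt x * b.
Proof.
by rewrite /pre_tgt /pre_act [(_, _).1]/= [(_, _).2]/= tens_bdM mulrDr mulrDl.
Qed.

Lemma pre_tgt_exchange x y : pre_tgt (exchange x y) = 0.
Proof.
rewrite /exchange raddfB.
have E (p q : tens1) (c p' q' : A) : ttgt p = p' -> ttgt q = q' ->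
    pre_tgt (p + q, c) = p' + q' + c.
  by move=> <- <-; rewrite /pre_tgt raddfD.
have E2 c d : ttgt (tens_act c d 1) = c * ttgt d by rewrite tens_bdM mulr1.
have E1 d c : ttgt (tens_act 1 d c) = ttgt d * c by rewrite tens_bdM mul1r.
apply: etrans (exchange_sumt _ _ _).
apply: (congr2 (fun u v : A => u - v)); first exact: E (E1 _ _) (E2 _ _).
exact: E (E2 _ _) (E1 _ _).
Qed.

Lemma pre_tgt_rel x : cell_rel x -> pre_tgt x = 0.
Proof.
elim=> {x} [x y||x y _ x0 _ y0|a x b _ x0].
- exact: pre_tgt_exchange.
- exact: raddf0.
- by apply: etrans (raddfD _ _ _) (etrans (congr2 +%R x0 y0) (addr0 _)).
- by rewrite pre_tgt_act x0 mulr0 mul0r.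
Qed.

Definition src (f : cell) : A := pre_src (repr f).
Definition tgt (f : cell) : A := pre_tgt (repr f).

Lemma srcE x : src (cell_of x) = pre_src x.
Proof.
apply: subr0_eq; rewrite -(pre_src_rel (cell_rel_repr x)).
by apply: esym; apply: raddfB.
Qed.

Lemma tgtE x : tgt (cell_of x) = pre_tgt x.
Proof.
apply: subr0_eq; rewrite -(pre_tgt_rel (cell_rel_repr x)).
by apply: esym; apply: raddfB.
Qed.

Definition id1 (a : A) : cell := cell_of (0, a).

Definition monomial1 (u : {fmonom gen0 X}) (al : gen1 X) (v : {fmonom gen0 X}) :
  cell := cell_of (<< (u, al, v) >>, 0).

(* Meaningful only if tgt f = src g. *)
Definition star0 (f g : cell) : cell := f - id1 (tgt f) + g.

Definition left_monomial : Prop :=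
  forall al : gen1 X, exists2 m, gsrc al = << m >> & m \notin msupp (gtgt al).

(* The clause src f = << m >> reads the monomial s(f) off as an element of the
   free monoid; under left-monomiality there is exactly one such m. *)
Definition rewriting_step (h : cell) : Prop :=
  exists u al v (c : K) (a : A) m,
    let f := monomial1 u al v in
    [/\ c != 0, src f = << m >>, m \notin msupp a & h = c *: f + id1 a].

Inductive positive_cell : cell -> Prop :=
| positive_id a : positive_cell (id1 a)
| positive_comp f g :
    rewriting_step f -> positive_cell g -> tgt f = src g ->
    positive_cell (star0 f g).

Definition reduced (a : A) : Prop :=
  ~ exists2 h, rewriting_step h & src h = a.

Definition normal_form (a b : A) : Prop :=
  reduced b /\ exists f, [/\ positive_cell f, src f = a & tgt f = b].

Inductive succX : {fmonom gen0 X} -> {fmonom gen0 X} -> Prop :=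
| succX_gen (al : gen1 X) m v :
    gsrc al = << m >> -> v \in msupp (gtgt al) -> succX m v
| succX_mul u u' v w :
    succX u u' -> succX (mmul (mmul v u) w) (mmul (mmul v u') w)
| succX_trans u v w : succX u v -> succX v w -> succX u w.

Definition terminating : Prop := well_founded (fun u v => succX v u).

Definition confluent : Prop :=
  forall f g, positive_cell f -> positive_cell g -> src f = src g ->
  exists h k, [/\ positive_cell h, positive_cell k, src h = tgt f, src k = tgt g
                & tgt h = tgt k].

End FreeOneAlgebra.

Definition subspace (K : fieldType) (V : lmodType K) (U : V -> Prop) : Prop :=
  U 0 /\ forall (c : K) u v, U u -> U v -> U (c *: u + v).

Definition direct_decomposition (K : fieldType) (V : lmodType K)
    (U W : V -> Prop) : Prop :=
  [/\ subspace U, subspace W,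
      forall x, exists u w, [/\ U u, W w & x = u + w]
    & forall x, U x -> W x -> x = 0].

(* Main.v *)
Require Import Defs.
From Stdlib Require Import Relation_Operators Operators_Properties.
From mathcomp Require Import all_boot all_algebra.
From mathcomp Require Import finmap.
From mathcomp Require Import monalg.
From mathcomp Require Import boolp.

(** Sources and targets are linear, so positive 1-cells [a -> b] exist exactly
    when [b] is reachable from [a] by elementary reductions: for an instance
    [m -> n] of a generating 1-cell between monomials, with [m] in the support
    of [a], replace [a] by [a - a@_m *: (<< m >> - n)].  The rest of the argument
    is about this relation [rewrites] on the free algebra ([rewrites_toP]).

    Termination enters twice.  It forbids [m] in the support of [n], so that
    [reduce_at m n] is a linear projection killing the coefficient of [m].  And
    it gives a normal form to every 0-cell ([normal_form_exists]): a reduction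
    removes one monomial from the support and adds only smaller ones, which is
    a descent in the finite-set extension of the monomial order, well founded
    by [wf_fset_below].

    (i) => (ii).  Reduction is not compatible with addition, because adding [z]
    may change or cancel the coefficient that is being reduced.  Joinability is:
    as [reduce_at m n] is a projection, [x + z] and [reduce_at m n x + z] have
    the same image under it ([rewrites_add]).  Under confluence, joinability is
    transitive, so the 0-cells joinable with [0] are closed under sums; as they
    contain the multiples of all [<< m >> - n], which span the ideal, they
    contain the ideal.  Joinable with the reduced [0] means reducing to [0].

    (ii) => (iii).  A 0-cell is its normal form plus an element of the ideal,
    and a reduced element of the ideal can only be its own normal form [0].

    (iii) => (i).  Two 0-cells reachable from the same one have normal forms
    whose difference is both reduced and in the ideal, hence [0]. *)

Set Implicit Arguments.
Unset Strict Implicit.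
Unset Printing Implicit Defensive.

Import GRing.Theory.
Local Open Scope ring_scope.

(** * Well-foundedness of the finite-set extension of a relation *)

Section FsetBelow.
Variables (T : choiceType) (lt : T -> T -> Prop).

(** The Dershowitz-Manna order, for sets instead of multisets.  Elements of [A]
    other than [m] may also be dropped from [B]; cancellation in supports
    requires this. *)
Definition fset_below (B A : {fset T}) : Prop :=
  exists2 m, m \in A & forall k, k \in B -> (k \in A /\ k != m) \/ lt k m.

Lemma fset_below_subr (A A' B : {fset T}) :
  (A `<=` A')%fset -> fset_below B A -> fset_below B A'.
Proof.
move=> /fsubsetP sAA' [m mA mB]; exists m; first exact: sAA'.
by move=> k /mB [[kA km]|]; [left; split => //; exact: sAA' | right].
Qed.

Lemma Acc_fset_below_sub (A A' : {fset T}) :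
  (A `<=` A')%fset -> Acc fset_below A' -> Acc fset_below A.
Proof.
move=> sAA' [accA']; constructor=> B B_A.
by apply: accA'; apply: fset_below_subr B_A.
Qed.

(** By induction on [m], then on [A]: a descent from [m |` A] either happens
    inside [A], where the inner induction applies, or replaces [m] by finitely
    many smaller elements, which the outer induction adds back one by one to a
    subset of [A]. *)
Lemma Acc_fset_below_add m (A : {fset T}) :
  Acc lt m -> Acc fset_below A -> Acc fset_below (m |` A)%fset.
Proof.
move=> acc_m; elim: acc_m A => {}m _ IHm A accA.
elim: accA => {}A accA IHA; constructor=> B [m' m'A m'B].
have [eq_m|neq_m] := eqVneq m' m; last first.
  have BA : fset_below (B `\ m)%fset A.
    exists m'; first by move: m'A; rewrite !inE (negPf neq_m).
    move=> k; rewrite !inE => /andP[km /m'B [[]|lt_k]]; last by right.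
    by rewrite !inE (negPf km) /= => kA km'; left.
  apply: Acc_fset_below_sub (IHA _ BA).
  by apply/fsubsetP=> k kB; rewrite !inE kB andbT; case: eqVneq.
subst m'.
have addl (s : seq T) : (forall k, k \in s -> lt k m) ->
    Acc fset_below ([fset k in s] `|` A)%fset.
  elim: s => [_|k s IHs lt_s].
    apply: (@Acc_fset_below_sub _ A); last by constructor.
    by apply/fsubsetP=> k; rewrite !inE.
  have /IHm/(_ ([fset k in s] `|` A)%fset) accC :=
    lt_s k (mem_head _ _).
  apply: Acc_fset_below_sub (accC _).
    by apply/fsubsetP=> k'; rewrite !inE orbA.
  by apply: IHs => k' k's; apply: lt_s; rewrite inE k's orbT.
apply: Acc_fset_below_sub (addl [seq k <- B | k \notin A] _).
  apply/fsubsetP=> k kB; rewrite !inE mem_filter kB andbT.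
  by case: (k \in A).
move=> k; rewrite mem_filter => /andP[kA /m'B [[]|//]].
by rewrite !inE (negPf kA) orbF => /eqP->; rewrite eqxx.
Qed.

Lemma wf_fset_below : well_founded lt -> well_founded fset_below.
Proof.
move=> wf_lt A; suff acc (s : seq T) : Acc fset_below [fset k in s]%fset.
  apply: Acc_fset_below_sub (acc A).
  by apply/fsubsetP=> k; rewrite !inE.
elim: s => [|m s IHs].
  by constructor=> B [m]; rewrite !inE.
apply: Acc_fset_below_sub (Acc_fset_below_add (wf_lt m) IHs).
by apply/fsubsetP=> k; rewrite !inE.
Qed.

End FsetBelow.

(** * Supports in the monoid algebra *)

Section Support.
Variables (K : fieldType).

Lemma msupp_lin_ext (T U : choiceType) (f : T -> {malg K[U]})
    (x : {malg K[T]}) k :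
  k \in msupp (lin_ext f x) -> exists2 w, w \in msupp x & k \in msupp (f w).
Proof.
move=> kx; apply: contrapT => no_w.
move: kx; rewrite -mcoeff_neq0 /lin_ext raddf_sum /=.
rewrite big_seq big1 ?eqxx // => w wx.
rewrite mcoeffZ (mcoeff_outdom (g := f w)) ?mulr0 //.
by apply/negP=> kw; apply: no_w; exists w.
Qed.

Lemma malgU_inj (M : choiceType) :
  injective (fun k : M => << k >> : {malg K[M]}).
Proof.
move=> k l /(congr1 (fun g : {malg K[M]} => g@_k)).
rewrite !mcoeffU eqxx; case: eqVneq => // _ /eqP.
by rewrite oner_eq0.
Qed.

Lemma malgUM3 (M : monomType) (u w v : M) :
  << u >> * << w >> * << v >> = << mmul (mmul u w) v >> :> {malg K[M]}.
Proof. by rewrite (malgUM K (mmul u w) v) (malgUM K u w). Qed.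

End Support.

(** * From positive 1-cells to a relation on 0-cells *)

Section Rewriting.
Variables (K : fieldType) (X : polygraph1 K).
Local Notation M := {fmonom gen0 X}.
Local Notation A := (free_alg K (gen0 X)).
Implicit Types (a b x y z n : A) (m : M).

(** Boundary data of a 1-monomial [u al v] whose source is the monomial [m]. *)
Definition mono_rule m n : Prop :=
  exists u al v, << m >> = << u >> * gsrc al * << v >>
              /\ n = << u >> * gtgt al * << v >>.

(** The target of the rewriting step that applies a rule [m -> n] to [a]: writing
    [a = c *: << m >> + a'] with [m] outside the support of [a'], this is
    [c *: n + a'].  The formula is linear in [a] and makes sense also for
    [c = 0], where it leaves [a] unchanged. *)
Definition reduce_at m n a : A := a - a@_m *: (<< m >> - n).

Definition rewrites a b : Prop :=
  exists m n, [/\ mono_rule m n, m \in msupp a & b = reduce_at m n a].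

Definition rewrites_to : A -> A -> Prop := clos_refl_trans_1n A rewrites.

Lemma rewrites_to_trans a b c :
  rewrites_to a b -> rewrites_to b c -> rewrites_to a c.
Proof.
rewrite /rewrites_to -!clos_rt_rt1n_iff; exact: rt_trans.
Qed.

Lemma pre_tgtZ c (x : precell X) : pre_tgt (c *: x) = c *: pre_tgt x.
Proof.
by rewrite /pre_tgt [(c *: x).1]/= [(c *: x).2]/= linearZ scalerDr.
Qed.

Lemma pre_srcZ c (x : precell X) : pre_src (c *: x) = c *: pre_src x.
Proof.
by rewrite /pre_src [(c *: x).1]/= [(c *: x).2]/= linearZ scalerDr.
Qed.

Lemma srcD (f g : cell X) : src (f + g) = src f + src g.
Proof.
have [x ->] := cell_ofP f; have [y ->] := cell_ofP g.
by rewrite -raddfD !srcE raddfD.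
Qed.

Lemma tgtD (f g : cell X) : tgt (f + g) = tgt f + tgt g.
Proof.
have [x ->] := cell_ofP f; have [y ->] := cell_ofP g.
by rewrite -raddfD !tgtE raddfD.
Qed.

Lemma srcZ c (f : cell X) : src (c *: f) = c *: src f.
Proof.
have [x ->] := cell_ofP f.
by rewrite [c *: _]cell_scaleE !srcE pre_srcZ.
Qed.

Lemma tgtZ c (f : cell X) : tgt (c *: f) = c *: tgt f.
Proof.
have [x ->] := cell_ofP f.
by rewrite [c *: _]cell_scaleE !tgtE pre_tgtZ.
Qed.

Lemma src_id1 a : src (id1 a) = a.
Proof. by rewrite srcE /pre_src raddf0 add0r. Qed.

Lemma tgt_id1 a : tgt (id1 a) = a.
Proof. by rewrite tgtE /pre_tgt raddf0 add0r. Qed.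

Lemma src_monomial1 (u v : M) (al : gen1 X) :
  src (monomial1 u al v) = << u >> * gsrc al * << v >>.
Proof. by rewrite srcE /pre_src addr0 tens_bdU. Qed.

Lemma tgt_monomial1 (u v : M) (al : gen1 X) :
  tgt (monomial1 u al v) = << u >> * gtgt al * << v >>.
Proof. by rewrite tgtE /pre_tgt addr0 tens_bdU. Qed.

Lemma src_star0 (f g : cell X) : tgt f = src g -> src (star0 f g) = src f.
Proof.
move=> fg; rewrite /star0 -scaleN1r !srcD srcZ src_id1 fg scaleN1r.
by rewrite addrNK.
Qed.

Lemma tgt_star0 (f g : cell X) : tgt (star0 f g) = tgt g.
Proof.
by rewrite /star0 -scaleN1r !tgtD tgtZ tgt_id1 scaleN1r subrr add0r.
Qed.

(** The decomposition [a = c *: << m >> + a'] in a rewriting step is determined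
    by [a] and [m], since [c] has to be the coefficient of [m] in [a]. *)
Lemma rewriting_step_rewrites (h : cell X) :
  rewriting_step h -> rewrites (src h) (tgt h).
Proof.
case=> u [al [v [c [a [m [c0 sm ma ->]]]]]].
have a_m : (c *: << m >> + a)@_m = c.
  by rewrite mcoeffD mcoeffZ mcoeffUU mulr1 (mcoeff_outdom ma) addr0.
exists m, (<< u >> * gtgt al * << v >>); split.
- by exists u, al, v; rewrite -sm src_monomial1.
- by rewrite srcD srcZ src_id1 sm -mcoeff_neq0 a_m.
rewrite /reduce_at srcD tgtD srcZ tgtZ src_id1 tgt_id1 sm a_m tgt_monomial1.
by rewrite scalerBr opprB addrAC addrCA addrA addrK addrC.
Qed.

Lemma rewrites_rewriting_step a b : rewrites a b ->
  exists h : cell X, [/\ rewriting_step h, src h = a & tgt h = b].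
Proof.
case=> m [n [[u [al [v [sm ->]]]] ma ->]].
exists (a@_m *: monomial1 u al v + id1 (a - a@_m *: << m >>)); split.
- exists u, al, v, a@_m, (a - a@_m *: << m >>), m; split=> //.
  + by rewrite mcoeff_neq0.
  + by rewrite src_monomial1.
  + by rewrite -mcoeff_eq0 mcoeffB mcoeffZ mcoeffUU mulr1 subrr.
- by rewrite srcD srcZ src_id1 src_monomial1 -sm addrC subrK.
- rewrite tgtD tgtZ tgt_id1 tgt_monomial1 /reduce_at scalerBr opprB.
  by rewrite addrCA.
Qed.

Lemma rewrites_toP a b : rewrites_to a b <->
  exists f : cell X, [/\ positive_cell f, src f = a & tgt f = b].
Proof.
split=> [|[f [f_pos <- <-]] {a b}].
  elim=> {a b} [a|a b c /rewrites_rewriting_step[h [h_step ha hb]] _].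
    by exists (id1 a); rewrite src_id1 tgt_id1; split=> //; left.
  case=> f [f_pos fb fc]; have hf : tgt h = src f by rewrite hb.
  exists (star0 h f); rewrite src_star0 // tgt_star0; split=> //.
  exact: positive_comp.
elim: f_pos => {f} [a|f g f_step _ IHg fg].
  by rewrite src_id1 tgt_id1; left.
rewrite src_star0 // tgt_star0; apply: Relation_Operators.rt1n_trans (IHg).
by rewrite -fg; exact: rewriting_step_rewrites.
Qed.

Lemma positive_rewrites_to (f : cell X) :
  positive_cell f -> rewrites_to (src f) (tgt f).
Proof. by move=> f_pos; apply/rewrites_toP; exists f. Qed.

Lemma reducedP a : reduced a <-> forall b, ~ rewrites a b.
Proof.
split=> [red_a b /rewrites_rewriting_step[h [h_step ha _]]|no_step].
  by apply: red_a; exists h.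
case=> h /rewriting_step_rewrites h_rw ha.
by move: h_rw; rewrite ha => /no_step.
Qed.

Lemma normal_formP a b : normal_form a b <-> reduced b /\ rewrites_to a b.
Proof. by rewrite /normal_form -rewrites_toP. Qed.

(** * Reduced 0-cells and the ideal *)

Lemma reduced_msuppP a :
  reduced a <-> forall m n, m \in msupp a -> ~ mono_rule m n.
Proof.
rewrite reducedP; split=> [red_a m n ma mn|no_rule b [m [n [mn ma _]]]].
  by apply: (red_a (reduce_at m n a)); exists m, n.
exact: no_rule mn.
Qed.

Lemma reduced_subspace : subspace (reduced (X := X)).
Proof.
split=> [|c u v]; rewrite !reduced_msuppP.
  by move=> m n; rewrite msupp0 inE.
move=> red_u red_v m n; rewrite -mcoeff_neq0 mcoeffD mcoeffZ => uv_m mn.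
have u_m : u@_m = 0 by apply/mcoeff_outdom/negP => /red_u/(_ mn).
have v_m : v@_m = 0 by apply/mcoeff_outdom/negP => /red_v/(_ mn).
by move: uv_m; rewrite u_m v_m mulr0 addr0 eqxx.
Qed.

Lemma in_idealZ c x : in_ideal x -> in_ideal (c *: x).
Proof. by move=> /(in_idealM (c *: 1) 1); rewrite mulr1 -scalerAl mul1r. Qed.

Lemma in_ideal_subspace : subspace (in_ideal (X := X)).
Proof.
split=> [|c u v u_I v_I]; first exact: in_ideal0.
by apply: in_idealD => //; apply: in_idealZ.
Qed.

Lemma mono_rule_ideal m n : mono_rule m n -> in_ideal (<< m >> - n).
Proof.
case=> u [al [v [-> ->]]]; rewrite -mulrBl -mulrBr.
by apply: in_idealM; apply: in_ideal_gen.
Qed.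

Lemma rewrites_to_ideal a b : rewrites_to a b -> in_ideal (a - b).
Proof.
elim=> {a b} [a|a b c [m [n [mn _ ->]]] _ bc].
  by rewrite subrr; exact: in_ideal0.
rewrite -(subrK (reduce_at m n a) a) -addrA; apply: in_idealD => //.
by rewrite /reduce_at opprB addrC subrK; exact/in_idealZ/mono_rule_ideal.
Qed.

(** * Existence of normal forms *)

Section Terminating.
Hypotheses (X_lm : left_monomial X) (X_term : terminating X).

Lemma mono_rule_succ m n k : mono_rule m n -> k \in msupp n -> succX m k.
Proof.
case=> u [al [v [def_m ->]]]; have [s def_s _] := X_lm al.
have -> : m = mmul (mmul u s) v.
  by apply: (@malgU_inj K); rewrite def_m def_s malgUM3.
rewrite -{1}(lin_ext_id (gtgt al)) lin_ext_mulr lin_ext_mull.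
case/msupp_lin_ext => w w_t; rewrite malgUM3 msuppU1 inE => /eqP->.
by apply: succX_mul; apply: succX_gen w_t.
Qed.

Lemma succX_irrefl m : ~ succX m m.
Proof.
by elim: (X_term m) => {}m _ IH mm; exact: (IH m mm mm).
Qed.

Lemma mono_rule_mcoeff m n : mono_rule m n -> n@_m = 0.
Proof.
by move=> mn; apply/mcoeff_outdom/negP => /(mono_rule_succ mn)/succX_irrefl.
Qed.

(** A monomial of [b = reduce_at m n a] lies in the support of [n], hence is
    smaller than [m], or it comes from [a]; it is not [m], whose coefficient
    has been cancelled. *)
Lemma rewrites_below a b : rewrites a b ->
  fset_below (fun u v => succX v u) (msupp b) (msupp a).
Proof.
case=> m [n [mn ma ->]]; exists m => // k; rewrite -mcoeff_neq0.
rewrite /reduce_at mcoeffB mcoeffZ mcoeffB mcoeffU1 => b_k.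
have [nk|nk] := boolP (k \in msupp n); first by right; exact: mono_rule_succ nk.
left; move: b_k; rewrite (mcoeff_outdom nk) subr0.
have [->|km] := eqVneq m k; first by rewrite mulr1 subrr eqxx.
by rewrite mulr0 subr0 mcoeff_neq0 => ->.
Qed.

Lemma normal_form_exists a : exists b, normal_form a b.
Proof.
suff [b ab] : exists b, reduced b /\ rewrites_to a b.
  by exists b; apply/normal_formP.
have := wf_fset_below X_term (msupp a); move def_S: (msupp a) => S acc.
elim: acc a def_S => {}S _ IH a def_S.
have [red_a|nred_a] := pselect (reduced a); first by exists a; split=> //; left.
have [b ab] : exists b, rewrites a b.
  apply: contrapT => no_b; apply: nred_a; apply/reducedP => b ab.
  by apply: no_b; exists b.
have [|c [red_c bc]] := IH (msupp b) _ b erefl.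
  by rewrite -def_S; exact: rewrites_below.
by exists c; split=> //; apply: Relation_Operators.rt1n_trans bc.
Qed.

(** * Joinability and the equivalence *)

Definition joinable x y : Prop := exists2 z, rewrites_to x z & rewrites_to y z.

Lemma reduce_at_rewrites m n a :
  mono_rule m n -> rewrites_to a (reduce_at m n a).
Proof.
move=> mn; have [ma|ma] := boolP (m \in msupp a).
  by apply: Relation_Operators.rt1n_trans (rt1n_refl _ _ _); exists m, n.
by rewrite /reduce_at (mcoeff_outdom ma) scale0r subr0; left.
Qed.

(** [reduce_at m n] is linear, and idempotent because [m] does not occur in
    [n]. *)
Lemma reduce_at_add m n x z : mono_rule m n ->
  reduce_at m n (reduce_at m n x + z) = reduce_at m n (x + z).
Proof.
move=> mn; have r_m : (reduce_at m n x)@_m = 0.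
  rewrite /reduce_at mcoeffB mcoeffZ mcoeffB mcoeffUU (mono_rule_mcoeff mn).
  by rewrite subr0 mulr1 subrr.
rewrite {1}/reduce_at mcoeffD r_m add0r /reduce_at mcoeffD scalerDl opprD.
by rewrite addrA [x - _ + z]addrAC.
Qed.

(** The common reduct is [reduce_at m n (x + z)]: it is reached from both sides
    in at most one step, zero steps being needed exactly when the coefficient
    of [m] vanishes. *)
Lemma rewrites_add x y z : rewrites x y -> joinable (x + z) (y + z).
Proof.
case=> m [n [mn _ ->]]; exists (reduce_at m n (x + z)).
  exact: reduce_at_rewrites.
by rewrite -reduce_at_add //; exact: reduce_at_rewrites.
Qed.

Lemma joinable_refl x : joinable x x. Proof. by exists x; left. Qed.

Lemma confluent_joinable_trans : confluent X ->
  forall y x z, joinable x y -> joinable y z -> joinable x z.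
Proof.
move=> X_conf y x z [t xt yt] [w yw zw].
have [f [f_pos fy ft]] := (rewrites_toP y t).1 yt.
have [g [g_pos gy gw]] := (rewrites_toP y w).1 yw.
have [h [k [h_pos k_pos ht kw hk]]] :=
  X_conf f g f_pos g_pos (etrans fy (esym gy)).
exists (tgt h).
  apply: rewrites_to_trans xt _; rewrite -ft -ht.
  exact: positive_rewrites_to.
apply: rewrites_to_trans zw _; rewrite -gw -kw hk.
  exact: positive_rewrites_to.
Qed.

Lemma joinable_reducer x y : reduced y -> joinable x y -> rewrites_to x y.
Proof.
move=> /reducedP red_y [z xz yz]; suff <- : z = y by [].
by case: yz red_y => // b c yb _ /(_ _ yb).
Qed.

Lemma reduced0 : reduced (0 : A).
Proof. by case: reduced_subspace. Qed.

Section Confluent.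
Hypothesis X_conf : confluent X.

Lemma rewrites_to_add x y z : rewrites_to x y -> joinable (x + z) (y + z).
Proof.
elim=> {x y} [x|x y w xy _]; first exact: joinable_refl.
by apply: confluent_joinable_trans; rewrite //; exact: rewrites_add.
Qed.

Lemma joinable0D x y : joinable x 0 -> joinable y 0 -> joinable (x + y) 0.
Proof.
move=> /(joinable_reducer reduced0) x0; apply: confluent_joinable_trans => //.
by rewrite -[y in joinable _ y]add0r; exact: rewrites_to_add.
Qed.

Lemma joinable0_sum (I : choiceType) (r : seq I) (F : I -> A) :
  (forall i, joinable (F i) 0) -> joinable (\sum_(i <- r) F i) 0.
Proof.
move=> F0; apply: (big_ind (joinable^~ 0)) => //; last exact: joinable0D.
exact: joinable_refl.
Qed.

Lemma mono_rule_joinable0 c m n :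
  mono_rule m n -> joinable (c *: (<< m >> - n)) 0.
Proof.
move=> mn; exists 0; last by left.
(* The coefficient of [m] in [c *: (<< m >> - n)] is [c], so reducing at [m]
   subtracts the whole element. *)
have := reduce_at_rewrites (c *: (<< m >> - n)) mn.
rewrite /reduce_at mcoeffZ mcoeffB mcoeffUU (mono_rule_mcoeff mn).
by rewrite subr0 mulr1 subrr.
Qed.

Lemma boundary_joinable0 c (u v : M) (al : gen1 X) :
  joinable (c *: (<< u >> * boundary al * << v >>)) 0.
Proof.
have [s def_s _] := X_lm al.
have def_m : << mmul (mmul u s) v >> = << u >> * gsrc al * << v >>.
  by rewrite def_s (malgUM3 K u s v).
have /(mono_rule_joinable0 c) :
    mono_rule (mmul (mmul u s) v) (<< u >> * gtgt al * << v >>).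
  by exists u, al, v; split; [exact: def_m | exact: erefl].
by rewrite def_m /boundary mulrBr mulrBl.
Qed.

(** The property is not visibly stable under multiplication on both sides, so
    the induction carries arbitrary multipliers [p] and [q]; expanding them on
    monomials reduces the generators to multiples of [<< m >> - n]. *)
Lemma in_ideal_joinable0 x : in_ideal x -> joinable x 0.
Proof.
move=> x_I; suff /(_ 1 1) : forall p q, joinable (p * x * q) 0.
  by rewrite mulr1 mul1r.
elim: x_I => {x} [al||x y _ IHx _ IHy|a x b _ IH] p q.
- rewrite -(lin_ext_id p) -(lin_ext_id q) lin_ext_mull lin_ext_mull.
  apply: joinable0_sum => u; rewrite lin_ext_mulr scaler_sumr.
  apply: joinable0_sum => v; rewrite scalerA; exact: boundary_joinable0.
- by rewrite mulr0 mul0r; exact: joinable_refl.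
- by rewrite mulrDr mulrDl; apply: joinable0D.
- by rewrite !mulrA -[_ * b * q]mulrA; exact: IH.
Qed.

Lemma in_ideal_normal_form0 x : in_ideal x -> normal_form x 0.
Proof.
move=> /in_ideal_joinable0/(joinable_reducer reduced0) x0.
by apply/normal_formP; split=> //; exact: reduced0.
Qed.

End Confluent.

Lemma normal_form0_decomposition :
  (forall a, in_ideal a -> normal_form a 0) ->
  direct_decomposition (reduced (X := X)) (in_ideal (X := X)).
Proof.
move=> nf0; split; [exact: reduced_subspace|exact: in_ideal_subspace| |].
  move=> x; have [b /normal_formP[red_b xb]] := normal_form_exists x.
  exists b, (x - b); split=> //; first exact: rewrites_to_ideal.
  by rewrite addrC subrK.
move=> x /reducedP red_x /nf0/normal_formP[_ x0].
by case: x0 red_x => // b c xb _ /(_ _ xb).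
Qed.

Lemma decomposition_confluent :
  direct_decomposition (reduced (X := X)) (in_ideal (X := X)) -> confluent X.
Proof.
case=> _ _ _ red_ideal0 f g f_pos g_pos fg.
have [b [red_b [h [h_pos hf hb]]]] := normal_form_exists (tgt f).
have [c [red_c [k [k_pos kg kc]]]] := normal_form_exists (tgt g).
exists h, k; split=> //; rewrite hb kc.
apply: subr0_eq; apply: red_ideal0.
  by rewrite addrC -scaleN1r; apply: (reduced_subspace.2).
have fb : in_ideal (src f - b).
  apply/rewrites_to_ideal/(rewrites_to_trans (positive_rewrites_to f_pos)).
  by rewrite -hf -hb; exact: positive_rewrites_to.
have gc : in_ideal (src f - c).
  rewrite fg; apply/rewrites_to_ideal.
  apply: (rewrites_to_trans (positive_rewrites_to g_pos)).
  by rewrite -kg -kc; exact: positive_rewrites_to.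
have := in_ideal_subspace.2 (-1) _ _ fb gc.
by rewrite scaleN1r opprB addrA subrK.
Qed.

End Terminating.
End Rewriting.

Theorem proposition3p3p4 (K : fieldType) (X : polygraph1 K)
    (X_lm : left_monomial X) (X_term : terminating X) :
  (confluent X <-> forall a : free_alg K (gen0 X), in_ideal a -> normal_form a 0)
  /\
  (confluent X <->
     direct_decomposition (reduced (X := X)) (in_ideal (X := X))).
Proof.
have i_ii : confluent X ->
    forall a : free_alg K (gen0 X), in_ideal a -> normal_form a 0.
  by move=> X_conf a; exact: in_ideal_normal_form0.
have ii_iii := normal_form0_decomposition X_lm X_term.
have iii_i := decomposition_confluent X_lm X_term.
split; split.
- exact: i_ii.
- by move=> /ii_iii/iii_i.
- by move=> /i_ii/ii_iii.
- exact: iii_i.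
Qed.
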